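(* Let $$M=\begin{bmatrix} M_1 & C_{12} & \cdots & C_{1k}\\ C_{12}^T & M_2 &\cdots & C_{2k}\\ \vdots & \vdots & \ddots & \vdots\\ C_{1k}^T & C_{2k}^T & \cdots & M_k\end{bmatrix}$$ be a real symmetric matrix, where $M_j$ is an $n_j\times n_j$ symmetric matrix and $C_{ij}$ is an $n_i\times n_j$ matrix. Suppose there exist nonzero vectors $\mathbf{w}_j\in\mathbb{R}^{n_j}$, $1\le j\le k$, and real scalars $\lambda_j,\alpha_{ij},\beta_{ij}$ such that $$M_j\mathbf{w}_j=\lambda_j\mathbf{w}_j\ (1\le j\le k),\qquad C_{ij}\mathbf{w}_j=\alpha_{ij}\mathbf{w}_i,\qquad C_{ij}^T\mathbf{w}_i=\beta_{ij}\mathbf{w}_j\quad (1\le i<j\le k).$$ Let $\mathbf{u}_j=[0,\ldots,0,\mathbf{w}_j,0,\ldots,0]^T$, where $\mathbf{w}_j$ occupies the $j$th block, and suppose that each $\mathbf{u}_j$ is a unit vector (so that $\alpha_{ij}=\beta_{ij}$ for all $i<j$). Let $H=(h_{ij})_{i,j=1}^k$ be the real symmetric matrix with $h_{ij}=\alpha_{ij}$ if $i<j$, $h_{jj}=\lambda_j$, and $h_{ij}=\beta_{ji}$ if $i>j$. Let $$M'=\begin{bmatrix} M & B\\ B^T & F\end{bmatrix}\quad\text{with}\quad B^T\mathbf{u}_j=\mathbf{0}\ \text{ for all } 1\le j\le k,$$ where $B$ is a real matrix and $F$ is a real symmetric matrix of appropriate orders. Then, for distinct $a,b\in\{1,\dots,k\}$,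 the graph associated with the matrix $H$ exhibits fractional revival from vertex $a$ to vertex $b$ if and only if the graph associated with the matrix $M'$ exhibits fractional revival from $[\mathbf{u}_a,\mathbf{0}]^T$ to $[\mathbf{u}_b,\mathbf{0}]^T$.
   Context: For a real symmetric matrix $N$, put $U_N(t)=\exp(itN)$, $t\in\mathbb{R}$; the (weighted) graph associated with $N$ is the graph whose continuous-time quantum walk has Hamiltonian $N$. For linearly independent vectors (states) $\mathbf{u},\mathbf{v}$, the graph associated with $N$ exhibits fractional revival from $\mathbf{u}$ to $\mathbf{v}$ if there exist a time $\tau$ and complex scalars $\alpha,\beta$ with $\beta\neq0$ such that $U_N(\tau)\mathbf{u}=\alpha\mathbf{u}+\beta\mathbf{v}$. Fractional revival from vertex $a$ to vertex $b$ means fractional revival from the standard basis vector $\mathbf{e}_a$ to $\mathbf{e}_b$. $[\mathbf{u},\mathbf{0}]^T$ denotes the column vector obtained by stacking $\mathbf{u}$ on top of a zero vector. *)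

(* Defs.v *)
From HB Require Import structures.
From mathcomp Require Export all_boot all_order all_algebra complex.
From mathcomp Require Export all_classical all_reals all_analysis.

Set Implicit Arguments.
Unset Strict Implicit.
Unset Printing Implicit Defensive.

Export Order.TTheory GRing.Theory Num.Theory numFieldNormedType.Exports.

Local Open Scope complex_scope.
Local Open Scope classical_set_scope.
Local Open Scope ring_scope.

(* Limit of the partial sums in the normed space of matrices; over R[i] the
   series converges for every A, so that the limit is never a default value. *)
Definition expmx (K : numFieldType) (n : nat) (A : 'M[K]_n) : 'M[K]_n :=
  limn (series (fun k : nat => (k`!%:R)^-1 *: A ^+ k)).

Definition cplx_mx (R : realType) (m n : nat) (A : 'M[R]_(m, n)) :
    'M[R[i]]_(m, n) :=
  map_mx (real_complex R) A.

(* 'i%C is (0 +i* 1). *)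
Definition walk_mx (R : realType) (n : nat) (N : 'M[R]_n) (t : R) :
    'M[R[i]]_n :=
  expmx (('i%C * t%:C) *: cplx_mx N).

(* States are complex vectors; independence is over the complex numbers. *)
Definition fractional_revival (R : realType) (n : nat) (N : 'M[R]_n)
    (u v : 'cV[R[i]]_n) : Prop :=
  free [:: u; v] /\
  exists (tau : R) (alpha beta : R[i]),
    beta != 0 /\ walk_mx N tau *m u = alpha *: u + beta *: v.

Definition vertex_fractional_revival (R : realType) (n : nat) (N : 'M[R]_n)
    (a b : 'I_n) : Prop :=
  fractional_revival N (delta_mx a 0) (delta_mx b 0).

(* The library norm on matrices is the sup norm, hence this definition. *)
Definition euclid_norm (R : realType) (n : nat) (x : 'cV[R]_n) : R :=
  Num.sqrt (\sum_(i < n) x i 0 ^+ 2).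

(* conform_mx only serves as a cast: when i = j it returns D i. Of C, only the
   entries with i < j are used. *)
Definition sym_mxblock (R : realType) (k : nat) (n : 'I_k -> nat)
    (D : forall i : 'I_k, 'M[R]_(n i))
    (C : forall i j : 'I_k, 'M[R]_(n i, n j)) : 'M[R]_(\sum_i n i) :=
  \mxblock_(i, j) if i == j then conform_mx 0 (D i)
                  else if (i < j)%N then C i j else (C j i)^T.

Definition block_vec (R : realType) (k : nat) (n : 'I_k -> nat)
    (w : forall i : 'I_k, 'cV[R]_(n i)) (j : 'I_k) : 'cV[R]_(\sum_i n i) :=
  \mxcol_i if i == j then w i else 0.

Definition quotient_mx (R : realType) (k : nat) (lambda : 'I_k -> R)
    (alpha beta : 'I_k -> 'I_k -> R) : 'M[R]_k :=
  \matrix_(i, j) if i == j then lambda j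
                 else if (i < j)%N then alpha i j else beta j i.

(* Main.v *)
Require Import Defs.

(** Let [U] be the matrix whose columns are the vectors [u_j], and let [V] be
    [U] padded with zero rows.  The relations satisfied by the [w_j] say that
    the span of the [u_j] is invariant under [M], which acts on it through [H]:
    [M U = U H] ([sym_mxblock_intertwine]).  Since [B^T U = 0], padding with
    zeros gives [M' V = V H]: the walk on [M'] cannot leave the span.  An
    intertwining relation passes to powers, hence to exponentials
    ([expmx_intertwine]), so that [exp(itM') V = V exp(itH)].  The [u_j] are
    unit vectors with disjoint supports, thus orthonormal, and [V^T V = 1]
    ([block_vecs_mx_orthonormal]); so [V] is injective and maps the basis
    vector [e_j] to the state [(u_j, 0)].  Applying [V] to the equation of
    fractional revival for [H] gives the one for [M'] with the same time and
    scalars, and injectivity allows the converse; linear independence is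
    preserved in both directions ([fractional_revival_intertwine]).

    The only analytic point is that a limit commutes with a product by [V] only
    once the exponential series is known to converge.  This is proved entry by
    entry, by comparison of the real and imaginary parts with the exponential
    series of a real number ([is_cvg_expmx]). *)

Set Implicit Arguments.
Unset Strict Implicit.
Unset Printing Implicit Defensive.

Local Open Scope complex_scope.
Local Open Scope classical_set_scope.
Local Open Scope ring_scope.

(** * Convergence of the matrix exponential *)

Lemma cvg_mx (K : numFieldType) (p q : nat) (T : Type) (G : set_system T)
    (FG : Filter G) (f : T -> 'M[K]_(p, q)) (A : 'M[K]_(p, q)) :
  (forall i j, f x i j @[x --> G] --> A i j) -> f @ G --> A.
Proof.
move=> fA; apply/cvg_mx_entourageP => E entE; near=> x => i j; rewrite inE.
move: i j; near: x; apply: filter_forall => i; apply: filter_forall => j.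
exact: (cvg_app_entourageP _ _ _).1 (fA i j) E entE.
Unshelve. all: by end_near. Qed.

Lemma cvg_mulmx (K : numFieldType) (p q r : nat) (T : Type) (G : set_system T)
    (FG : Filter G) (f : T -> 'M[K]_(p, q)) (g : T -> 'M[K]_(q, r))
    (A : 'M[K]_(p, q)) (B : 'M[K]_(q, r)) :
  f @ G --> A -> g @ G --> B -> f x *m g x @[x --> G] --> A *m B.
Proof.
move=> fA gB; apply: cvg_mx => i j; rewrite mxE.
under eq_fun do rewrite mxE.
apply: cvg_big => [|l _]; first exact: add_continuous.
apply: cvgM.
- exact: (cvg_comp _ _ fA (@coord_continuous _ _ _ i l A)).
- exact: (cvg_comp _ _ gB (@coord_continuous _ _ _ l j B)).
Qed.

Lemma real_complex_continuous (R : realType) :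
  continuous (real_complex R : R -> (R[i] : numFieldType)).
Proof.
move=> x; apply/cvgrPdist_lt => e e0.
have eE : (complex.Re e)%:C = e by apply: RRe_real; exact: gtr0_real.
have e0' : 0 < complex.Re e by rewrite -ltcR eE.
near=> y; rewrite -rmorphB/= -eE normc_def/= expr0n addr0 sqrtr_sqr ltcR.
by near: y; apply: cvgr_dist_lt.
Unshelve. all: by end_near. Qed.

Lemma normc_ge_Im (R : rcfType) (z : R[i]) : `|complex.Im z|%:C <= `|z|.
Proof.
rewrite normc_def lecR -sqrtr_sqr ler_wsqrtr// lerDr; exact: sqr_ge0.
Qed.

(** Real and imaginary parts are bounded in modulus by [r], so that both series
    converge absolutely; this way the completeness of the reals suffices. *)
Lemma is_cvg_complex_series (R : realType) (z : (R[i] : numFieldType) ^nat)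
    (r : R ^nat) :
  (forall k, `|z k| <= (r k)%:C) -> cvgn (series r) -> cvgn (series z).
Proof.
move=> zr cr.
have dominated (x : R ^nat) : (forall k, `|x k|%:C <= `|z k|) ->
    cvgn (series x).
  move=> xz; apply: normed_cvg; apply: (series_le_cvg _ _ _ cr) => k.
  - exact: normr_ge0.
  - by rewrite -lecR; apply: le_trans (zr k); exact: normr_ge0.
  - by rewrite -lecR; apply: le_trans (xz k) (zr k).
have cRe := dominated _ (fun k => normc_ge_Re (z k)).
have cIm := dominated _ (fun k => normc_ge_Im (z k)).
have -> : series z = (fun k => (series (fun k => complex.Re (z k)) k)%:C +
    'i%C * (series (fun k => complex.Im (z k)) k)%:C).
  apply/funext => k; rewrite /series/= !rmorph_sum/= mulr_sumr -big_split/=.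
  by apply: eq_bigr => i _; rewrite -complexE.
apply: is_cvgD; last apply: is_cvgMl_tmp.
- apply: cvgP; exact: cvg_comp cRe (@real_complex_continuous R _).
- apply: cvgP; exact: cvg_comp cIm (@real_complex_continuous R _).
Qed.

(** The sum of the moduli of the entries is a submultiplicative norm that
    dominates each entry. *)
Lemma norm_exprmx_entry (K : numDomainType) (n : nat) (A : 'M[K]_n) (k : nat)
    (i j : 'I_n) :
  `|(A ^+ k) i j| <= (\sum_i \sum_j `|A i j|) ^+ k.
Proof.
elim: k i j => [|k IH] i j.
  by rewrite !expr0 mxE; case: (_ == _); rewrite ?normr1 ?normr0 ?ler01.
rewrite exprSr mxE (le_trans (ler_norm_sum _ _ _))// exprSr mulr_sumr.
apply: ler_sum => l _; rewrite normrM ler_pM//.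
by rewrite (bigD1 j)//= lerDl sumr_ge0.
Qed.

Lemma is_cvg_expmx (R : realType) (n : nat) (A : 'M[R[i] : numFieldType]_n) :
  cvgn (series (fun k : nat => (k`!%:R)^-1 *: A ^+ k)).
Proof.
pose c := \sum_i \sum_j `|A i j|.
(* [c] lives in the complex field, whereas the comparison needs a real bound. *)
have cE : (complex.Re c)%:C = c.
  by apply/RRe_real/ger0_real/sumr_ge0 => i _; apply: sumr_ge0.
have cvg_entry i j : cvgn (series (fun k => (k`!%:R)^-1 * (A ^+ k) i j)).
  apply: is_cvg_complex_series (is_cvg_series_exp_coeff (complex.Re c)) => k.
  rewrite /exp_coeff/= rmorphM/= rmorphXn/= cE fmorphV/= rmorph_nat.
  rewrite normrM normrV ?unitfE ?pnatr_eq0 -?lt0n ?fact_gt0// normr_nat mulrC.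
  by rewrite ler_wpM2r ?invr_ge0// norm_exprmx_entry.
apply/cvg_ex; exists (\matrix_(i, j)
  limn (series (fun k => (k`!%:R)^-1 * (A ^+ k) i j))).
apply: cvg_mx => i j; rewrite mxE.
rewrite (_ : (fun x => _) = series (fun k => (k`!%:R)^-1 * (A ^+ k) i j)).
  exact: cvg_entry.
by apply/funext => k; rewrite /series/= summxE; apply: eq_bigr => l _;
  rewrite mxE.
Qed.

(** * Intertwined walks *)

Lemma exprmx_intertwine (K : pzSemiRingType) (p q : nat) (A : 'M[K]_p)
    (B : 'M[K]_q) (U : 'M[K]_(p, q)) (k : nat) :
  A *m U = U *m B -> A ^+ k *m U = U *m B ^+ k.
Proof.
move=> AU; elim: k => [|k IH]; first by rewrite !expr0 mul1mx mulmx1.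
by rewrite exprS -mulmxA IH mulmxA AU -mulmxA [in RHS]exprS.
Qed.

(** The relation holds between the partial sums, and passes to the limit because
    both series converge. *)
Lemma expmx_intertwine (R : realType) (p q : nat)
    (A : 'M[R[i] : numFieldType]_p) (B : 'M[R[i] : numFieldType]_q)
    (U : 'M[R[i] : numFieldType]_(p, q)) :
  A *m U = U *m B -> expmx A *m U = U *m expmx B.
Proof.
move=> AU.
pose eA := series (fun k : nat => (k`!%:R)^-1 *: A ^+ k).
pose eB := series (fun k : nat => (k`!%:R)^-1 *: B ^+ k).
have eU : (fun k => eA k *m U) = (fun k => U *m eB k).
  apply/funext => k; rewrite /eA /eB /series/= mulmx_suml mulmx_sumr.
  apply: eq_bigr => l _.
  by rewrite -scalemxAl -scalemxAr (exprmx_intertwine _ AU).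
have cA : eA k *m U @[k --> \oo] --> expmx A *m U.
  by apply: cvg_mulmx; [exact: is_cvg_expmx | exact: cvg_cst].
have cB : U *m eB k @[k --> \oo] --> U *m expmx B.
  by apply: cvg_mulmx; [exact: cvg_cst | exact: is_cvg_expmx].
rewrite eU in cA; exact: cvg_unique cA cB.
Qed.

Lemma walk_mx_intertwine (R : realType) (p q : nat) (N : 'M[R]_p)
    (H : 'M[R]_q) (U : 'M[R]_(p, q)) (t : R) :
  N *m U = U *m H -> walk_mx N t *m cplx_mx U = cplx_mx U *m walk_mx H t.
Proof.
move=> NU; apply: expmx_intertwine.
by rewrite -scalemxAl -scalemxAr -!map_mxM NU.
Qed.

Lemma free_map_mulmx (K : fieldType) (p q n : nat) (L : 'M[K]_(q, p))
    (U : 'M[K]_(p, q)) (X : n.-tuple 'cV[K]_q) :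
  L *m U = 1%:M -> free [tuple of map (mulmx U) X] = free X.
Proof.
move=> LU; have Uinj : injective (mulmx U : 'cV_q -> 'cV_p).
  by move=> x y /(congr1 (mulmx L)); rewrite !mulmxA LU !mul1mx.
have sumE (k : 'I_n -> K) : \sum_i k i *: [tuple of map (mulmx U) X]`_i =
    U *m \sum_i k i *: X`_i.
  rewrite mulmx_sumr; apply: eq_bigr => i _.
  by rewrite (nth_map 0) ?size_tuple//= scalemxAr.
apply/freeP/freeP => freeX k kX; apply: freeX.
- by rewrite sumE kX mulmx0.
- by apply: Uinj; rewrite -sumE kX mulmx0.
Qed.

(** [U] embeds the walk of [H] isometrically as the restriction of the walk of
    [N] to an invariant subspace, and revival between two states of that
    subspace can be read inside it. *)
Lemma fractional_revival_intertwine (R : realType) (p q : nat) (N : 'M[R]_p)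
    (H : 'M[R]_q) (U : 'M[R]_(p, q)) (x y : 'cV[R[i]]_q) :
  N *m U = U *m H -> U^T *m U = 1%:M ->
  fractional_revival H x y <->
  fractional_revival N (cplx_mx U *m x) (cplx_mx U *m y).
Proof.
move=> NU UU.
have cUU : cplx_mx U^T *m cplx_mx U = 1%:M by rewrite -map_mxM UU map_mx1.
have Uinj : injective (mulmx (cplx_mx U) : 'cV_q -> 'cV_p).
  by move=> x' y' /(congr1 (mulmx (cplx_mx U^T))); rewrite !mulmxA cUU !mul1mx.
have revE (tau : R) (al be : R[i]) :
    walk_mx N tau *m (cplx_mx U *m x) = al *: (cplx_mx U *m x) +
      be *: (cplx_mx U *m y) <->
    walk_mx H tau *m x = al *: x + be *: y.
  rewrite mulmxA (walk_mx_intertwine _ NU) -mulmxA !scalemxAr -mulmxDr.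
  by split=> [/Uinj|->].
rewrite /fractional_revival.
have /= -> := free_map_mulmx [tuple x; y] cUU.
by split=> -[? [tau [al [be [? /revE]]]]]; split=> //; exists tau, al, be.
Qed.

(** * The invariant subspace spanned by the block vectors *)

Lemma trmx_mul_euclid_norm (R : realType) (n : nat) (x : 'cV[R]_n) :
  x^T *m x = (euclid_norm x ^+ 2)%:M.
Proof.
apply/matrixP => i j; rewrite !ord1 !mxE eqxx mulr1n sqr_sqrtr.
  by apply: eq_bigr => l _; rewrite mxE.
by apply: sumr_ge0 => l _; exact: sqr_ge0.
Qed.

(** The matrix with columns [block_vec w j], given by its block rows:
    [w i] in column [i] and zeros elsewhere.  In this form products with block
    matrices reduce to one identity per block. *)
Definition block_vecs_mx (R : realType) (k : nat) (n : 'I_k -> nat)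
    (w : forall i : 'I_k, 'cV[R]_(n i)) : 'M[R]_(\sum_i n i, k) :=
  \mxcol_i (w i *m delta_mx 0 i).

Lemma col_block_vecs_mx (R : realType) (k : nat) (n : 'I_k -> nat)
    (w : forall i : 'I_k, 'cV[R]_(n i)) (j : 'I_k) :
  col j (block_vecs_mx w) = block_vec w j.
Proof.
rewrite /block_vecs_mx /block_vec col_mxcol; apply/eq_mxcol => i.
rewrite colE -mulmxA; have [->|ij] := eqVneq i j.
  by rewrite mul_delta_mx; apply/colP => r; rewrite mxE big_ord1 mxE mulr1.
by rewrite mul_delta_mx_0 ?mulmx0.
Qed.

(** Distinct block vectors have disjoint supports, so that the Gram matrix is
    diagonal whatever the [w i] are; the norms make it the identity. *)
Lemma block_vecs_mx_orthonormal (R : realType) (k : nat) (n : 'I_k -> nat)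
    (w : forall i : 'I_k, 'cV[R]_(n i)) :
  (forall j, euclid_norm (block_vec w j) = 1) ->
  (block_vecs_mx w)^T *m block_vecs_mx w = 1%:M.
Proof.
move=> w1; have ww i : (w i)^T *m w i = 1%:M.
  have := trmx_mul_euclid_norm (block_vec w i); rewrite w1 expr1n => <-.
  rewrite /block_vec tr_mxcol mul_mxrow_mxcol (bigD1 i)//= eqxx big1 ?addr0//.
  by move=> l /negPf ->; rewrite mulmx0.
rewrite tr_mxcol mul_mxrow_mxcol mx1_sum_delta; apply: eq_bigr => i _.
by rewrite trmx_mul trmx_delta mulmxA -(mulmxA _ (w i)^T) ww mulmx1
  mul_delta_mx.
Qed.

(** The block in position [(i, j)] sends [w j] to a multiple of [w i], and the
    quotient matrix collects the coefficients.  Below the diagonal the block is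
    the transpose of [C j i], which accounts for [beta j i]. *)
Lemma sym_mxblock_intertwine (R : realType) (k : nat) (n : 'I_k -> nat)
    (D : forall i : 'I_k, 'M[R]_(n i))
    (C : forall i j : 'I_k, 'M[R]_(n i, n j))
    (w : forall i : 'I_k, 'cV[R]_(n i)) (lambda : 'I_k -> R)
    (alpha beta : 'I_k -> 'I_k -> R) :
  (forall i, D i *m w i = lambda i *: w i) ->
  (forall i j : 'I_k, (i < j)%N -> C i j *m w j = alpha i j *: w i) ->
  (forall i j : 'I_k, (i < j)%N -> (C i j)^T *m w i = beta i j *: w j) ->
  sym_mxblock D C *m block_vecs_mx w =
  block_vecs_mx w *m quotient_mx lambda alpha beta.
Proof.
move=> Dw Cw Ctw; set H := quotient_mx _ _ _.
rewrite /sym_mxblock mul_mxblock_mxrow mxcol_mul; apply/eq_mxcol => i.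
rewrite -mulmxA -rowE [row i H]row_sum_delta mulmx_sumr.
apply: eq_bigr => j _; rewrite mulmxA -scalemxAr scalemxAl; congr (_ *m _).
rewrite !mxE; have [<-|neq_ij] := eqVneq i j; first by rewrite conform_mx_id Dw.
case: ltnP => [/Cw //|]; rewrite leq_eqVlt => /orP[/eqP/val_inj eq_ji|/Ctw //].
by rewrite eq_ji eqxx in neq_ij.
Qed.

Theorem theorem6 (R : realType) (k : nat) (n : 'I_k -> nat)
    (Md : forall j : 'I_k, 'M[R]_(n j))
    (C : forall i j : 'I_k, 'M[R]_(n i, n j))
    (M : 'M[R]_(\sum_i n i))
    (M_blocks : M = sym_mxblock Md C)
    (M_sym : M^T = M)
    (Md_sym : forall j : 'I_k, (Md j)^T = Md j)
    (w : forall j : 'I_k, 'cV[R]_(n j))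
    (w_neq0 : forall j : 'I_k, w j != 0)
    (lambda : 'I_k -> R) (alpha beta : 'I_k -> 'I_k -> R)
    (Md_w : forall j : 'I_k, Md j *m w j = lambda j *: w j)
    (C_w : forall i j : 'I_k, (i < j)%N -> C i j *m w j = alpha i j *: w i)
    (Ctr_w : forall i j : 'I_k, (i < j)%N ->
       (C i j)^T *m w i = beta i j *: w j)
    (u_unit : forall j : 'I_k, euclid_norm (block_vec w j) = 1)
    (m : nat) (B : 'M[R]_(\sum_i n i, m)) (F : 'M[R]_m)
    (F_sym : F^T = F)
    (B_u : forall j : 'I_k, B^T *m block_vec w j = 0)
    (a b : 'I_k) (a_neq_b : a != b) :
  vertex_fractional_revival (quotient_mx lambda alpha beta) a b <->
  fractional_revival (block_mx M B B^T F)
    (cplx_mx (col_mx (block_vec w a) 0)) (cplx_mx (col_mx (block_vec w b) 0)).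
Proof.
rewrite M_blocks; set H := quotient_mx _ _ _; set N := block_mx _ _ _ _.
pose U := block_vecs_mx w.
pose V := col_mx U 0 : 'M[R]_(\sum_i n i + m, k).
have BU : B^T *m U = 0.
  apply/matrixP => r j; have /colP/(_ r) := B_u j.
  by rewrite -col_block_vecs_mx colE mulmxA -colE !mxE.
have NV : N *m V = V *m H.
  rewrite mul_block_col mul_col_mx !mulmx0 !addr0 mul0mx BU.
  by rewrite (sym_mxblock_intertwine Md_w C_w Ctr_w).
have VV : V^T *m V = 1%:M.
  by rewrite tr_col_mx mul_row_col trmx0 mul0mx addr0 block_vecs_mx_orthonormal.
have Ve j : cplx_mx V *m delta_mx j 0 = cplx_mx (col_mx (block_vec w j) 0).
  by rewrite -colE -map_col col_col_mx col_block_vecs_mx col0.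
by rewrite -!Ve; exact: fractional_revival_intertwine.
Qed.
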